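(* Consider an influence diagram with all notation as in the context. Assume $(y^{*},z^{*})$ is an optimal solution of the problem $$\max_{z,y}\ \sum_{s_O\in S_O}\mathbb{E}_U(s_O)\,y(s_O)$$ subject to $\sum_{s_d\in S_d}z(s_d\mid s_{I(d)})=1$ for all $d\in D$, $s_{I(d)}\in S_{I(d)}$; $\sum_{s_O\in E_O(s_d,s_{I(d)})}y(s_O)\le\Gamma(s_d\mid s_{I(d)})\,z(s_d\mid s_{I(d)})$ for all $d\in D$, $s_d\in S_d$, $s_{I(d)}\in S_{I(d)}$; $z(s_d\mid s_{I(d)})\in\{0,1\}$ for all $d\in D$, $s_d\in S_d$, $s_{I(d)}\in S_{I(d)}$; $y(s_O)\in[0,1]$ for all $s_O\in S_O$. Define $x^{*}(s)=y^{*}(s_O)$ for all $s\in S^{>}$, where $s_O$ is the restriction of $s$ to $O$. Then $(x^{*},z^{*})$ is an optimal solution of the problem $$\max_{z,x}\ \sum_{s\in S^{>}}p(s)U(s)x(s)$$ subject to $\sum_{s_d\in S_d}z(s_d\mid s_{I(d)})=1$ for all $d\in D$, $s_{I(d)}\in S_{I(d)}$; $\sum_{s\in E^{>}(s_d,s_{I(d)})}x(s)\le\Gamma(s_d\mid s_{I(d)})\,z(s_d\mid s_{I(d)})$ for all $d\in D$, $s_d\in S_d$, $s_{I(d)}\in S_{I(d)}$; $z(s_d\mid s_{I(d)})\in\{0,1\}$ for all $d\in D$, $s_d\in S_d$, $s_{I(d)}\in S_{I(d)}$; $x(s)\in[0,1]$ for all $s\in S^{>}$.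
   Context: An influence diagram is a finite acyclic directed graph with node set $C\cup D\cup V$ (disjoint): chance nodes $C$, decision nodes $D$, value nodes $V$; value nodes have no children. For a node $n$, the information set $I(n)$ is the set of its direct parents (so $I(n)\subseteq C\cup D$). Each $n\in C\cup D$ has a finite nonempty state set $S_n$. For $M\subseteq C\cup D$, $S_M=\prod_{m\in M}S_m$, and elements are written $s_M=(s_m)_{m\in M}$; for $s\in S:=S_{C\cup D}$ (a path), $s_M$ denotes its restriction to $M$. Each chance node $c$ has a conditional probability distribution $\mathbb{P}(\cdot\mid s_{I(c)})$ on $S_c$ for every $s_{I(c)}\in S_{I(c)}$. For a path $s$, $p(s)=\prod_{c\in C}\mathbb{P}(s_c\mid s_{I(c)})$, and $S^{>}=\{s\in S: p(s)>0\}$. Each value node $v$ has a real utility function on $S_{I(v)}$, and $U(s)=\sum_{v\in V}U(s_{I(v)})$; it is assumed throughout that $U(s)>0$ for all $s\in S$. For $M\subseteq C\cup D$ and $s_M\in S_M$: $E(s_M)=\{s'\in S: s'_M=s_M\}$ and $E^{>}(s_M)=E(s_M)\cap S^{>}$. $C_I=\{c\in C:\exists d\in D,\ c\in I(d)\}$ and $O=D\cup C_I$ (the observation set). For $M\subseteq O$ and $s_M\in S_M$, $E_O(s_M)=\{s'_O\in S_O: s'_M=s_M\}$. For $d\in D$, $E(s_d,s_{I(d)})$ means $E(s_{\{d\}\cup I(d)})$, and likewise for $E^{>}$ and $E_O$ (note $\{d\}\cup I(d)\subseteq O$). For $s_O\in S_O$, $\mathbb{E}_U(s_O)=\sum_{s\in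 E(s_O)}p(s)U(s)$. The constants are $$\Gamma(s_d\mid s_{I(d)})=\min\left\{|E^{>}(s_d,s_{I(d)})|,\ \frac{|E(s_d,s_{I(d)})|}{\prod_{k\in D\setminus(\{d\}\cup I(d))}|S_k|}\right\}.$$ *)

(* Defs.v *)
From HB Require Import structures.
From mathcomp Require Import all_boot all_order all_algebra.
From mathcomp Require Import reals.

Set Implicit Arguments.
Unset Strict Implicit.
Unset Printing Implicit Defensive.

Import Order.TTheory GRing.Theory Num.Theory.
Local Open Scope ring_scope.

(* The node set is the disjoint union C + D + V, so disjointness holds by
   typing; only the nodes of C + D carry states. *)
Record diagram_graph := DiagramGraph {
  chance : finType;
  decision : finType;
  value : finType;
  arc : rel (chance + decision + value);
  arc_acyclic : forall w : seq (chance + decision + value),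
    cycle arc w -> w = [::];
  arc_value : forall (v : value) (n : chance + decision + value),
    ~~ arc (inr v) n;
  state : chance + decision -> finType;
  state_gt0 : forall n : chance + decision, (0 < #|state n|)%N
}.

Definition snode (G : diagram_graph) : finType := (chance G + decision G)%type.

Definition chance_node (G : diagram_graph) (c : chance G) : snode G := inl c.
Definition decision_node (G : diagram_graph) (d : decision G) : snode G :=
  inr d.

(* I(n), as a set of chance and decision nodes: by [arc_value] these are the
   only possible parents. *)
Definition info_set (G : diagram_graph)
    (n : chance G + decision G + value G) : {set snode G} :=
  [set m : snode G | arc (inl m) n].

Definition info_chance (G : diagram_graph) (c : chance G) : {set snode G} :=
  info_set (inl (inl c)).
Definition info (G : diagram_graph) (d : decision G) : {set snode G} :=
  info_set (inl (inr d)).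
Definition info_value (G : diagram_graph) (v : value G) : {set snode G} :=
  info_set (inr v).

(* S_M *)
Definition config (G : diagram_graph) (M : {set snode G}) : finType :=
  {dffun forall m : {m : snode G | m \in M}, state (val m)}.

(* S = S_(C u D) *)
Definition spath (G : diagram_graph) : finType :=
  {dffun forall n : snode G, state n}.

(* s_M, for s in S *)
Definition restrict (G : diagram_graph) (M : {set snode G}) (s : spath G) :
    config M :=
  [ffun m : {m : snode G | m \in M} => s (val m)].

(* s_M, for s in S_M' with M included in M' *)
Definition restrict_sub (G : diagram_graph) (M M' : {set snode G})
    (sMM' : M \subset M') (s : config M') : config M :=
  [ffun m : {m : snode G | m \in M} =>
     s (exist _ (val m) (subsetP sMM' (val m) (valP m)))].

Definition decision_set (G : diagram_graph) : {set snode G} :=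
  [set decision_node d | d : decision G].

Definition observed_chance (G : diagram_graph) : {set snode G} :=
  [set chance_node c | c : chance G &
     [exists d : decision G, chance_node c \in info d]].

(* O = D u C_I *)
Definition obs (G : diagram_graph) : {set snode G} :=
  decision_set G :|: observed_chance G.

Lemma decision_obs (G : diagram_graph) (d : decision G) :
  decision_node d \in obs G.
Proof. by apply/setUP; left; apply: imset_f. Qed.

Lemma info_obs (G : diagram_graph) (d : decision G) : info d \subset obs G.
Proof.
apply/subsetP => -[c|k] mI; last exact: decision_obs.
apply/setUP; right; apply/imsetP; exists c => //.
by rewrite inE; apply/existsP; exists d.
Qed.

Record influence_diagram (R : realType) := InfluenceDiagram {
  graph :> diagram_graph;
  prob : forall c : chance graph,
    config (info_chance c) -> state (chance_node c) -> R;
  prob_ge0 : forall (c : chance graph) (sI : config (info_chance c))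
    (sc : state (chance_node c)), 0 <= prob sI sc;
  prob_sum1 : forall (c : chance graph) (sI : config (info_chance c)),
    \sum_(sc : state (chance_node c)) prob sI sc = 1;
  utility : forall v : value graph, config (info_value v) -> R
}.

Section Events.
Variables (R : realType) (G : influence_diagram R).

Definition path_prob (s : spath G) : R :=
  \prod_(c : chance G)
    prob (restrict (info_chance c) s) (s (chance_node c)).

Definition path_utility (s : spath G) : R :=
  \sum_(v : value G) utility (restrict (info_value v) s).

(* S^> *)
Definition pos_paths : {set spath G} := [set s : spath G | 0 < path_prob s].

(* E(s_M) *)
Definition event (M : {set snode G}) (sM : config M) : {set spath G} :=
  [set s : spath G | restrict M s == sM].

(* E(s_d, s_I(d)): since d is not in I(d), an element of S_({d} u I(d)) is
   a pair (s_d, s_I(d)). *)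
Definition devent (d : decision G) (sI : config (info d))
    (sd : state (decision_node d)) : {set spath G} :=
  [set s : spath G |
     (s (decision_node d) == sd) && (restrict (info d) s == sI)].

(* E^>(s_d, s_I(d)) *)
Definition pos_devent (d : decision G) (sI : config (info d))
    (sd : state (decision_node d)) : {set spath G} :=
  devent sI sd :&: pos_paths.

(* E_O(s_d, s_I(d)) *)
Definition obs_devent (d : decision G) (sI : config (info d))
    (sd : state (decision_node d)) : {set config (obs G)} :=
  [set sO : config (obs G) |
     (sO (exist _ (decision_node d) (decision_obs d)) == sd) &&
     (restrict_sub (info_obs d) sO == sI)].

(* E_U(s_O) *)
Definition obs_utility (sO : config (obs G)) : R :=
  \sum_(s in event sO) path_prob s * path_utility s.

Definition Gamma (d : decision G) (sI : config (info d))
    (sd : state (decision_node d)) : R :=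
  Num.min #|pos_devent sI sd|%:R
    (#|devent sI sd|%:R /
     \prod_(k in decision_set G :\: (decision_node d |: info d))
       #|state k|%:R).

End Events.

Definition optimal (R : realType) (T : Type) (feasible : T -> Prop)
    (objective : T -> R) (t : T) : Prop :=
  feasible t /\ forall t' : T, feasible t' -> objective t' <= objective t.

Section Problems.
Variables (R : realType) (G : influence_diagram R).

(* [z d sI sd] is z(s_d | s_I(d)). *)
Definition zvar : Type :=
  forall d : decision G, config (info d) -> state (decision_node d) -> R.

Definition yvar : Type := config (obs G) -> R.

Definition xvar : Type := {s : spath G | s \in pos_paths G} -> R.

Definition strategy_constraints (z : zvar) : Prop :=
  (forall (d : decision G) (sI : config (info d)),
     \sum_(sd : state (decision_node d)) z d sI sd = 1) /\
  (forall (d : decision G) (sI : config (info d))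
     (sd : state (decision_node d)), z d sI sd = 0 \/ z d sI sd = 1).

Definition obs_feasible (yz : yvar * zvar) : Prop :=
  let: (y, z) := yz in
  [/\ strategy_constraints z,
      forall (d : decision G) (sI : config (info d))
        (sd : state (decision_node d)),
        \sum_(sO in obs_devent sI sd) y sO <= Gamma sI sd * z d sI sd
    & forall sO : config (obs G), 0 <= y sO <= 1].

Definition obs_objective (yz : yvar * zvar) : R :=
  \sum_(sO : config (obs G)) obs_utility sO * yz.1 sO.

Definition path_feasible (xz : xvar * zvar) : Prop :=
  let: (x, z) := xz in
  [/\ strategy_constraints z,
      forall (d : decision G) (sI : config (info d))
        (sd : state (decision_node d)),
        \sum_(s : {s : spath G | s \in pos_paths G} |
              val s \in pos_devent sI sd) x s <= Gamma sI sd * z d sI sd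
    & forall s : {s : spath G | s \in pos_paths G}, 0 <= x s <= 1].

Definition path_objective (xz : xvar * zvar) : R :=
  \sum_(s : {s : spath G | s \in pos_paths G})
    path_prob (val s) * path_utility (val s) * xz.1 s.

End Problems.

(* Main.v *)
(* Fix a strategy z. In either problem a feasible y or x vanishes outside the
   paths that comply with z, and at most Gamma(s_d | s_I(d)) complying paths of
   positive probability lie in E(s_d, s_I(d)): by acyclicity a complying path is
   determined by its chance states, so changing the states of the decisions
   outside {d} u I(d) arbitrarily is injective on complying paths. Hence y
   lifts to a feasible x with the same objective; conversely, as p U > 0 on
   S^>, any feasible (x, z) is dominated by the lift of the indicator of the
   restrictions to O of complying paths in S^>, which is feasible for y. *)

Require Import Defs.
From HB Require Import structures.
From mathcomp Require Import all_boot all_order all_algebra.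
From mathcomp Require Import reals.

Set Implicit Arguments.
Unset Strict Implicit.
Unset Printing Implicit Defensive.

Import Order.TTheory GRing.Theory Num.Theory.
Local Open Scope ring_scope.

(** Every node is its own ancestor, but [n] is not an ancestor of [m]: a walk from [n] to [m] would
    close a cycle with the arc from [m] to [n]. The count ranks nodes for induction along arcs. *)
Lemma acyclic_card_ancestors (T : finType) (e : rel T)
    (e_acyclic : forall w : seq T, cycle e w -> w = [::]) (m n : T) :
  e m n -> (#|[set k | connect e k m]| < #|[set k | connect e k n]|)%N.
Proof.
move=> emn; apply/proper_card/properP; split.
  apply/subsetP => k; rewrite !inE => ekm.
  exact: connect_trans ekm (connect1 emn).
exists n; rewrite !inE ?connect0 //; apply/negP => /connectP[p pnp mE].
suff: n :: p = [::] by [].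
by apply: e_acyclic; rewrite /= rcons_path pnp -mE.
Qed.

Section Paths.
Variables (R : realType) (G : influence_diagram R).
Implicit Types (z : zvar G) (s : spath G) (d : decision G).

(** [obs G] contains every decision and its information set, so compliance already makes sense for
    the arguments of [y]. *)
Definition complies_obs z (sO : config (obs G)) : bool :=
  [forall d, z d (restrict_sub (info_obs d) sO)
               (sO (exist _ (decision_node d) (decision_obs d))) == 1].

Definition complies z s : bool := complies_obs z (restrict (obs G) s).

Lemma restrict_sub_restrict (M M' : {set snode G}) (sMM' : M \subset M') s :
  restrict_sub sMM' (restrict M' s) = restrict M s.
Proof. by apply/ffunP => m; rewrite !ffunE. Qed.

Lemma compliesP z s :
  reflect (forall d, z d (restrict (info d) s) (s (decision_node d)) = 1)
          (complies z s).
Proof.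
apply: (iffP forallP) => zs d; have := zs d;
  by rewrite restrict_sub_restrict ffunE => /eqP.
Qed.

Lemma mem_obs_devent d (sI : config (info d)) sd s :
  (restrict (obs G) s \in obs_devent sI sd) = (s \in devent sI sd).
Proof. by rewrite !inE restrict_sub_restrict ffunE. Qed.

Lemma strategy_inj z d (sI : config (info d)) sd sd' :
  strategy_constraints z -> z d sI sd = 1 -> z d sI sd' = 1 -> sd = sd'.
Proof.
move=> [zsum z01] zsd zsd'; apply/eqP/negPn/negP => neq.
(* Cancelling the term at [sd] leaves nonnegative terms with sum 0, among them the term at [sd'],
   which is 1. *)
have := zsum d sI; rewrite (bigD1 sd) //= zsd -[RHS]addr0 => /addrI /eqP.
rewrite psumr_eq0 => [/allP/(_ sd')|k _]; last by case: (z01 d sI k) => ->.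
by rewrite mem_index_enum zsd' eq_sym neq oner_eq0 => /(_ isT).
Qed.

(* Acyclicity lets the decisions be read off one after another. *)
Lemma complies_inj z s s' :
  strategy_constraints z -> complies z s -> complies z s' ->
  (forall c : chance G, s (chance_node c) = s' (chance_node c)) -> s = s'.
Proof.
move=> zstrat /compliesP zs /compliesP zs' eqC; apply/ffunP => n.
pose h (n : snode G) := #|[set k | connect (@Defs.arc G) k (inl n)]|.
have [k] := ubnP (h n); elim: k n => // k IHk [c|d] hk; first exact: eqC.
have eqI : restrict (info d) s = restrict (info d) s'.
  apply/ffunP => -[m mI]; rewrite !ffunE; apply: IHk.
  apply: leq_trans (hk : (h _ <= k)%N).
  apply: acyclic_card_ancestors (@arc_acyclic G) _ _ _.
  by have: m \in info d := mI; rewrite inE.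
by apply: (strategy_inj zstrat (zs d)); rewrite eqI; apply: zs'.
Qed.

(** Matching on the reflection proof supplies the membership proof that indexes [t]. *)
Definition override (K : {set snode G}) (s : spath G) (t : config K) :
    spath G :=
  [ffun n => if @idP (n \in K) is ReflectT nK then t (exist _ n nK) else s n].

Lemma override_in (K : {set snode G}) s (t : config K) n (nK : n \in K) :
  override s t n = t (exist _ n nK).
Proof.
rewrite ffunE; case: {-}_ / idP => [nK'|//].
by rewrite (bool_irrelevance nK' nK).
Qed.

Lemma override_notin (K : {set snode G}) s (t : config K) n :
  n \notin K -> override s t n = s n.
Proof. by rewrite ffunE; case: {-}_ / idP => // nK /negP[]. Qed.

Lemma card_config (K : {set snode G}) :
  #|config K| = (\prod_(k in K) #|state k|)%N.
Proof. by rewrite card_dep_ffun foldrE big_image [RHS]big_sub. Qed.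

(** Overriding a complying path on [K] keeps it in the event, as [K] avoids [d] and [info d]. It is
    injective on pairs: [K] has no chance nodes, so the chance states survive and determine the
    path, while [t] is read off on [K]. *)
Lemma card_complies_devent z d (sI : config (info d)) sd
    (K := decision_set G :\: (decision_node d |: info d)) :
  strategy_constraints z ->
  (#|[set s in devent sI sd | complies z s]| * \prod_(k in K) #|state k|
     <= #|devent sI sd|)%N.
Proof.
move=> zstrat; rewrite -card_config -cardsT -cardsX.
pose f (u : spath G * config K) := override u.1 u.2.
have fI : {in setX [set s in devent sI sd | complies z s] setT &, injective f}.
  move=> [s t] [s' t'] /setXP[/setIdP[_ zs] _] /setXP[/setIdP[_ zs'] _].
  rewrite /f /= => eqf.
  have -> : s = s'.
    apply: complies_inj zstrat zs zs' _ => c.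
    have cK : chance_node c \notin K.
      by rewrite inE negb_and orbC; apply/orP; left; apply/imsetP => -[].
    by rewrite -(override_notin s t cK) eqf override_notin.
  congr (_, _); apply/ffunP => -[n nK].
  by rewrite -(override_in s t nK) eqf override_in.
rewrite -(card_in_imset fI); apply/subset_leq_card/subsetP => u /imsetP[[s t]].
move=> /setXP[/setIdP[]]; rewrite inE => /andP[/eqP sdE /eqP sIE] _ _ ->.
rewrite /f inE /=; apply/andP; split.
  by rewrite override_notin ?sdE // !inE eqxx.
rewrite -sIE; apply/eqP/ffunP => -[m mI]; rewrite [LHS]ffunE [RHS]ffunE /=.
by rewrite override_notin // in_setD in_setU mI orbT.
Qed.

Lemma card_complies_Gamma z d (sI : config (info d)) sd :
  strategy_constraints z ->
  #|[set s in pos_devent sI sd | complies z s]|%:R <= Gamma sI sd :> R.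
Proof.
move=> zstrat; rewrite /Gamma le_min; apply/andP; split.
  by rewrite ler_nat; apply/subset_leq_card/subsetP => s /setIdP[].
(* State sets are nonempty, so the denominator is positive and can be cleared. *)
rewrite -natr_prod ler_pdivlMr ?ltr0n; last first.
  by rewrite prodn_gt0 // => k; apply: state_gt0.
rewrite -natrM ler_nat; apply: leq_trans (card_complies_devent sI sd zstrat).
rewrite leq_mul2r; apply/orP; right; apply/subset_leq_card/subsetP => s.
by rewrite !inE => /andP[/andP[-> _] ->].
Qed.

Definition path_lift (y : yvar G) : xvar G :=
  fun u => y (restrict (obs G) (val u)).

(** Paths are grouped by their restriction to [obs G]; those outside [pos_paths G] have probability
    0 and drop out. *)
Lemma obs_objectiveE (y : yvar G) z :
  obs_objective (y, z) = path_objective (path_lift y, z).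
Proof.
pose F s := path_prob s * path_utility s * y (restrict (obs G) s).
transitivity (\sum_(s : spath G) F s).
  rewrite (partition_big (@restrict G (obs G)) xpredT) //=.
  apply: eq_bigr => sO _; rewrite mulr_suml; apply: eq_big => [s|s].
    by rewrite inE.
  by rewrite inE /F => /eqP ->.
rewrite -[RHS](big_sub (pos_paths G) F) [RHS]big_mkcond /=.
apply: eq_bigr => s _; case: ifPn => //; rewrite inE lt0r negb_and negbK.
rewrite (_ : 0 <= path_prob s) ?orbF => [/eqP p0|].
  by rewrite /F p0 !mul0r.
by apply: prodr_ge0 => c _; apply: prob_ge0.
Qed.

Lemma path_objective_le (x x' : xvar G) z z' :
  (forall s : spath G, 0 < path_utility s) -> (forall u, x u <= x' u) ->
  path_objective (x, z) <= path_objective (x', z').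
Proof.
move=> U_gt0 xx'; apply: ler_sum => -[s sP] _ /=; apply: ler_wpM2l => //.
by move: (sP); rewrite inE => p0; rewrite mulr_ge0 // ltW.
Qed.

(** At a decision where [sO] departs from [z], the constraint has right-hand side 0, which forces
    its nonnegative terms to vanish. *)
Lemma obs_feasible_support (y : yvar G) z sO :
  obs_feasible (y, z) -> ~~ complies_obs z sO -> y sO = 0.
Proof.
move=> [[_ z01] yG y01] /forallPn[d zd].
set sI := restrict_sub _ _ in zd; set sd := sO _ in zd.
have := yG d sI sd; case: (z01 d sI sd) => [->|zd1];
  last by rewrite zd1 eqxx in zd.
have sOd : sO \in obs_devent sI sd by rewrite inE !eqxx.
rewrite mulr0 (bigD1 sO) //= => yle0; apply/eqP; rewrite eq_le.
have [-> _] := andP (y01 sO); rewrite andbT (le_trans _ yle0) // lerDl.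
by apply: sumr_ge0 => i _; case/andP: (y01 i).
Qed.

Lemma path_feasible_support (x : xvar G) z u :
  path_feasible (x, z) -> ~~ complies z (val u) -> x u = 0.
Proof.
move=> [[_ z01] xG x01] /forallPn[d]; rewrite restrict_sub_restrict ffunE /=.
set sI := restrict _ _; set sd := val u _ => zd.
have := xG d sI sd; case: (z01 d sI sd) => [->|zd1];
  last by rewrite zd1 eqxx in zd.
have sE : val u \in pos_devent sI sd by rewrite inE (valP u) andbT inE !eqxx.
rewrite mulr0 (bigD1 u) //= => xle0; apply/eqP; rewrite eq_le.
have [-> _] := andP (x01 u); rewrite andbT (le_trans _ xle0) // lerDl.
by apply: sumr_ge0 => i _; case/andP: (x01 i).
Qed.

Lemma complies_devent z d (sI : config (info d)) sd s :
  s \in devent sI sd -> complies z s -> z d sI sd = 1.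
Proof. by rewrite inE => /andP[/eqP<- /eqP<-] /compliesP. Qed.

Lemma obs_feasible_path (y : yvar G) z :
  obs_feasible (y, z) -> path_feasible (path_lift y, z).
Proof.
move=> yF; have [zstrat yG y01] := yF; split=> // [d sI sd|u];
  last exact: y01.
pose F s := y (restrict (obs G) s).
have F0 s : ~~ complies z s -> F s = 0 by apply: obs_feasible_support.
rewrite -[leLHS](big_sub_cond (pos_paths G)
  (fun s => s \in pos_devent sI sd) F).
rewrite (bigID (complies z)) /= [X in _ + X]big1 ?addr0; last first.
  by move=> s /andP[_ /F0].
(* If [z] is 0 here, the event has no complying path; if it is 1, each complying path contributes at
   most 1. *)
have [z0|z1] : z d sI sd = 0 \/ z d sI sd = 1 by case: zstrat => _; apply.
  rewrite z0 mulr0 big1 // => s /andP[/andP[_ /setIP[sE _]] zs].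
  by have := complies_devent sE zs; rewrite z0 => /esym/eqP; rewrite oner_eq0.
rewrite z1 mulr1; apply: le_trans (card_complies_Gamma sI sd zstrat).
rewrite -sum1dep_card natr_sum.
rewrite [leLHS](eq_bigl (fun s => (s \in pos_devent sI sd) && complies z s)).
  by apply: ler_sum => s _; case/andP: (y01 (restrict (obs G) s)).
by move=> s; rewrite /= in_setI andbCA andbb.
Qed.

Definition complying_indicator z : yvar G := fun sO =>
  (sO \in [set restrict (obs G) s
           | s in [set s in pos_paths G | complies z s]])%:R.

Lemma complying_indicator_feasible z :
  strategy_constraints z -> obs_feasible (complying_indicator z, z).
Proof.
move=> zstrat; split=> // [d sI sd|sO]; last first.
  by rewrite /complying_indicator; case: (_ \in _); rewrite /= ?lexx ?ler01.
set A := [set s in pos_devent sI sd | complies z s].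
(* Complying paths with the same restriction are counted once, so the sum is the size of an image of
   [A], hence at most [#|A|]. *)
have -> : \sum_(sO in obs_devent sI sd) complying_indicator z sO =
    #|restrict (obs G) @: A|%:R.
  rewrite -natr_sum -big_mkcondr sum1_card; congr _%:R; apply: eq_card => sO.
  rewrite [LHS]unfold_in; apply/andP/imsetP => [[sOd /imsetP[s sP sOE]]|[s]].
    exists s => //; move: sOd sP; rewrite sOE mem_obs_devent => sd_s.
    by rewrite in_set => /andP[sP zs]; rewrite in_set in_setI sd_s sP.
  rewrite in_set in_setI => /andP[/andP[sd_s sP] zs] ->.
  by rewrite mem_obs_devent sd_s imset_f // in_set sP.
have [z0|z1] : z d sI sd = 0 \/ z d sI sd = 1 by case: zstrat => _; apply.
  rewrite z0 mulr0 [A](_ : _ = set0) ?imset0 ?cards0 //.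
  apply/setP => s; rewrite [RHS]inE; apply/negP => /setIdP[/setIP[sE _] zs].
  by have := complies_devent sE zs; rewrite z0 => /esym/eqP; rewrite oner_eq0.
rewrite z1 mulr1; apply: le_trans (card_complies_Gamma sI sd zstrat).
by rewrite ler_nat leq_imset_card.
Qed.

End Paths.

Theorem proposition4 (R : realType) (G : influence_diagram R)
    (hU : forall s : spath G, 0 < path_utility s)
    (ystar : yvar G) (zstar : zvar G)
    (hopt : optimal (@obs_feasible R G) (@obs_objective R G) (ystar, zstar)) :
  let xstar : xvar G := fun s => ystar (restrict (obs G) (val s)) in
  optimal (@path_feasible R G) (@path_objective R G) (xstar, zstar).
Proof.
case: hopt => yF yopt /=; split; first exact: obs_feasible_path.
move=> [x z] xF; have [zstrat _ x01] := xF.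
have := yopt _ (complying_indicator_feasible zstrat).
(* It remains to compare [x] pointwise with the lifted indicator, which is 1 on complying paths;
   elsewhere [x] vanishes. *)
rewrite !obs_objectiveE; apply: le_trans; apply: path_objective_le => // s.
have [zs|zs] := boolP (complies z (val s)).
  rewrite /path_lift /complying_indicator (imset_f (@restrict G (obs G))).
    by case/andP: (x01 s).
  by rewrite inE zs (valP s).
by rewrite (path_feasible_support xF zs) /path_lift ler0n.
Qed.
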